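(* Let $f:\mathbb{R}^n\to\mathbb{R}^n$ be a locally Lipschitz vector field and let $V,\theta\in C^1(\mathbb{R}^n;\mathbb{R})$ be functions that satisfy $$\nabla V(x)f(x)\le 0\ \text{ for all } x\in\mathbb{R}^n,$$ $$\nabla\theta(x)f(x)\le 0\ \text{ for all } x\in\mathbb{R}^n \text{ with } \nabla V(x)f(x)=0.$$ Suppose that for every $z\in\mathbb{R}^n$ and for every $y\in\{x\in\mathbb{R}^n: V(x)\le V(z)\}$ the set $\{x\in\mathbb{R}^n: V(x)\le V(z),\ \theta(x)\le\theta(y)\}$ is compact. Moreover, assume that for every $z\in\mathbb{R}^n$ there exists $y_z\in\{x\in\mathbb{R}^n:V(x)\le V(z)\}$ with $\theta(y_z)\ge\theta(z)$ such that $$\{x\in\mathbb{R}^n: V(x)\le V(z)\}\subseteq\{x\in\mathbb{R}^n:\theta(x)\le\theta(y_z)\}\cup\{x\in\mathbb{R}^n:\nabla\theta(x)f(x)\le 0\}.$$ Consider the dynamical system $\dot x=f(x)$, $x\in\mathbb{R}^n$. Then for every $x_0\in\mathbb{R}^n$ the unique solution $x(t)$ of the initial value problem $\dot x=f(x)$, $x(0)=x_0$, is defined for all $t\ge 0$ and is bounded. If $\omega(x_0)$ denotes the positive limit set of $\{x(t):t\ge 0\}$, then for every $x_0\in\mathbb{R}^n$, $\omega(x_0)$ is a non-empty, compact, connected, invariant set which satisfies $$\omega(x_0)\subseteq\{x\in\mathbb{R}^n:\nabla V(x)f(x)=0\}\quad\text{and}\quad \omega(x_0)\cap\{x\in\mathbb{R}^n:\nabla\theta(x)f(x)=\nabla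 V(x)f(x)=0\}\ne\emptyset.$$
   Context: Gradients $\nabla V(x)$, $\nabla\theta(x)$ are row vectors, so $\nabla V(x)f(x)$ is a scalar. The positive limit set $\omega(x_0)$ is the set of all $p\in\mathbb{R}^n$ for which there is a sequence $t_i\to+\infty$ with $x(t_i)\to p$. A set is invariant if the solution of $\dot x=f(x)$ starting at any of its points exists for all $t\in\mathbb{R}$ and stays in the set. *)

(* Defs.v *)
From HB Require Import structures.
From mathcomp Require Import all_boot all_order all_algebra.
From mathcomp Require Import all_classical all_reals all_analysis.

Set Implicit Arguments.
Unset Strict Implicit.
Unset Printing Implicit Defensive.

Import Order.TTheory GRing.Theory Num.Theory.
Import numFieldNormedType.Exports.

Local Open Scope classical_set_scope.
Local Open Scope ring_scope.

(* Points of R^n are column vectors, so that a gradient (a row vector) can be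
   multiplied by the vector field. *)
Definition gradient (R : realType) (n : nat) (V : 'cV[R]_n -> R)
    (x : 'cV[R]_n) : 'rV[R]_n :=
  \row_(j < n) 'D_(delta_mx j 0) V x.

Definition grad_dot (R : realType) (n : nat) (V : 'cV[R]_n -> R)
    (f : 'cV[R]_n -> 'cV[R]_n) (x : 'cV[R]_n) : R :=
  (gradient V x *m f x) 0 0.

Definition continuously_differentiable (R : realType) (n : nat)
    (V : 'cV[R]_n -> R) : Prop :=
  (forall x, differentiable V x) /\ continuous (gradient V).

Definition locally_lipschitz (R : realType) (n : nat)
    (f : 'cV[R]_n -> 'cV[R]_n) : Prop :=
  forall x : 'cV[R]_n, exists2 U : set 'cV[R]_n, nbhs x U & [lipschitz f z | z in U].

(* [x] is a total function, of which only the values on the open interval [J]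
   are meaningful. *)
Definition ivp_solution (R : realType) (n : nat) (f : 'cV[R]_n -> 'cV[R]_n)
    (x0 : 'cV[R]_n) (J : set R) (x : R -> 'cV[R]_n) : Prop :=
  [/\ open J, is_interval J, J 0, x 0 = x0 &
      forall t, J t -> is_derive t 1 x (f (x t))].

(* "The unique solution" of the initial value problem: a solution of which
   every other one is a restriction. *)
Definition the_ivp_solution (R : realType) (n : nat)
    (f : 'cV[R]_n -> 'cV[R]_n) (x0 : 'cV[R]_n) (J : set R)
    (x : R -> 'cV[R]_n) : Prop :=
  ivp_solution f x0 J x /\
  forall (K : set R) (y : R -> 'cV[R]_n), ivp_solution f x0 K y ->
    K `<=` J /\ (forall t, K t -> y t = x t).

Definition positive_limit_set (R : realType) (n : nat)
    (x : R -> 'cV[R]_n) : set 'cV[R]_n :=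
  [set p | exists t : nat -> R,
     (t i @[i --> \oo] --> +oo) /\ (x (t i) @[i --> \oo] --> p)].

Definition invariant_set (R : realType) (n : nat) (f : 'cV[R]_n -> 'cV[R]_n)
    (A : set 'cV[R]_n) : Prop :=
  forall p, A p -> exists y : R -> 'cV[R]_n,
    the_ivp_solution f p setT y /\ (forall t, A (y t)).

(* Main.v *)
Require Import Defs.
From mathcomp Require Import all_boot all_order all_algebra.
From mathcomp Require Import all_classical all_reals all_analysis.
From mathcomp Require Import lra ring.

(* Along the solution from x0 the value of V does not increase, and theta cannot
   rise above theta(y_z), z := x0, since wherever it exceeds that value it does
   not increase; so the solution is trapped in the compact set
   K = {V <= V x0, theta <= theta y_z}. V is then constant on the limit set,
   which is invariant, so its derivative along f vanishes there. At a minimizer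
   p of theta on the limit set, the trajectory through p stays in the limit set,
   so theta is minimal along it at time 0 and its derivative along f is 0.

   All the dynamics is done with a truncation g of f: composing f with the
   clamping of each coordinate to [-r, r] gives a bounded, globally Lipschitz
   field equal to f on the ball of radius r, whose solutions exist for all times
   and depend continuously on the initial point. A solution of g that stays in
   the ball is a solution of f. *)

Set Implicit Arguments.
Unset Strict Implicit.

Import Order.TTheory GRing.Theory Num.Theory.
Import numFieldNormedType.Exports.

Local Open Scope classical_set_scope.
Local Open Scope ring_scope.

(** * Derivatives of curves *)

Lemma mx_norm_leP (R : realType) (m n : nat) (A : 'M[R]_(m, n)) (c : R) :
  0 <= c -> `|A| <= c <-> forall i j, `|A i j| <= c.
Proof.
move=> c0; rewrite [`|A|]/Num.Def.normr/= mx_normrE; split=> [Ac i j|Ac].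
  exact: le_trans (le_bigmax _ (fun ij => `|A ij.1 ij.2|) (i, j)) Ac.
by rewrite (bigmax_le _ c0).
Qed.

Lemma mx_norm_entry (R : realType) (m n : nat) (A : 'M[R]_(m, n)) i j :
  `|A i j| <= `|A|.
Proof. by have /mx_norm_leP : `|A| <= `|A| by []; apply. Qed.

Lemma is_derive_mxP (R : realType) (m n : nat) (M : R -> 'M[R]_(m, n))
    (t v : R) (dM : 'M[R]_(m, n)) :
  is_derive t v M dM <->
  forall i j, is_derive t v (fun s => M s i j) (dM i j).
Proof.
split=> [[Md <-] i j|Mij].
  split; first by move/derivable_mxP : Md; exact.
  by rewrite derive_mx// mxE.
have Md : derivable M t v by apply/derivable_mxP => i j; have [] := Mij i j.
split=> //; rewrite derive_mx//; apply/matrixP => i j; rewrite mxE.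
by have [] := Mij i j.
Qed.

(** Serves for time reversal ([a = -1]), for moving from 0 towards a time [t] of either sign
    ([a = Num.sg t]), and for time shifts by [c]. *)
Lemma is_derive_affine (R : realType) (m n : nat) (M : R -> 'M[R]_(m, n))
    (a c t : R) (dM : 'M[R]_(m, n)) :
  is_derive (a * t + c) 1 M dM ->
  is_derive t 1 (fun s => M (a * s + c)) (a *: dM).
Proof.
move=> /is_derive_mxP Md; apply/is_derive_mxP => i j; rewrite mxE mulrC.
apply: (@is_derive1_comp _ (fun s => M s i j) (fun s => a * s + c)) => //.
have -> : (fun s => a * s + c) = (a *: id + cst c : R -> R) by [].
by apply: is_derive_eq; rewrite addr0 /GRing.scale /= mulr1.
Qed.

Lemma is_derive_grad_dot (R : realType) (n : nat) (f : 'cV[R]_n -> 'cV[R]_n)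
    (V : 'cV[R]_n -> R) (x : R -> 'cV[R]_n) (t : R) :
  differentiable V (x t) -> is_derive t 1 x (f (x t)) ->
  is_derive t 1 (V \o x) (grad_dot V f (x t)).
Proof.
move=> dV [/derivable1_diffP dx xE].
have dVx : differentiable (V \o x) t by exact: differentiable_comp.
split; first exact/derivable1_diffP.
have xE' : 'd x t 1 = f (x t) by rewrite -deriveE.
rewrite deriveE// diff_comp//= xE' /grad_dot mxE.
(* [gradient] is made of partial derivatives, so the velocity is expanded in the standard basis and
   the differential is applied term by term. *)
have {1}-> : f (x t) = \sum_(j < n) f (x t) j 0 *: delta_mx j 0.
  by rewrite {1}[f _]matrix_sum_delta; apply: eq_bigr => j _; rewrite big_ord1.
rewrite linear_sum; apply: eq_bigr => j _.
by rewrite linearZ/= -deriveE// mxE mulrC.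
Qed.

Lemma is_derive_continuous (R : realType) (W : normedModType R) (x : R -> W)
    (t : R) (dx : W) : is_derive t 1 x dx -> {for t, continuous x}.
Proof. by move=> [/derivable1_diffP/differentiable_continuous]. Qed.

Lemma is_derive_within (R : realType) (W : normedModType R) (x dx : R -> W)
    (a b : R) : (forall s, a <= s <= b -> is_derive s 1 x (dx s)) ->
  {within `[a, b], continuous x}.
Proof.
move=> dxE; apply: continuous_in_subspaceT => s.
by rewrite inE/= in_itv/= => sab; exact: is_derive_continuous (dxE s sab).
Qed.

(** Mean value theorem. The sign of [du] is asked on the open interval only: in the trapping
    argument nothing is known about it at the left endpoint. *)
Lemma le0_is_derive_le (R : realType) (u du : R -> R) (a b : R) : a <= b ->
  (forall s, a <= s <= b -> is_derive s 1 u (du s)) ->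
  (forall s, a < s < b -> du s <= 0) -> u b <= u a.
Proof.
rewrite le_eqVlt => /predU1P[->//|ab] duE du0.
have duE' s : s \in `]a, b[%R -> is_derive s 1 u (du s).
  by rewrite in_itv/= => /andP[as_ sb]; apply: duE; rewrite !ltW.
have [c cab uE] := MVT ab duE' (is_derive_within duE).
rewrite -subr_le0 uE mulr_le0_ge0//; last by rewrite subr_ge0 ltW.
by apply: du0; move: cab; rewrite in_itv.
Qed.

(** Mean value inequality without integrals: the norm is the largest absolute value of an entry, and
    for each entry both [h i j - phi] and [- phi - h i j] have a nonpositive derivative. *)
Lemma is_derive_dominated (R : realType) (m n : nat) (h dh : R -> 'M[R]_(m, n))
    (phi dphi : R -> R) (a b : R) : a <= b ->
  (forall s, a <= s <= b -> is_derive s 1 h (dh s)) ->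
  (forall s, a <= s <= b -> is_derive s 1 phi (dphi s)) ->
  (forall s, a <= s <= b -> `|dh s| <= dphi s) ->
  `|h b - h a| <= phi b - phi a.
Proof.
move=> ab hE phiE le_dh.
have sW s : a < s < b -> a <= s <= b by move=> /andP[? ?]; rewrite !ltW.
have dhij s i j : a <= s <= b -> - dphi s <= dh s i j <= dphi s.
  by move=> sab; rewrite -ler_norml (le_trans (mx_norm_entry _ _ _))// le_dh.
have hij i j : `|h b i j - h a i j| <= phi b - phi a.
  rewrite ler_norml; apply/andP; split.
    have : (- phi b) - h b i j <= (- phi a) - h a i j.
      apply: (@le0_is_derive_le _ (fun s => - phi s - h s i j)
               (fun s => - dphi s - dh s i j)) => // s sab.
        have /is_derive_mxP/(_ i j) ? := hE _ sab.
        have ? := phiE _ sab.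
        exact: is_deriveB.
      by have /andP[] := dhij s i j (sW s sab); lra.
    by lra.
  have : h b i j - phi b <= h a i j - phi a.
    apply: (@le0_is_derive_le _ (fun s => h s i j - phi s)
             (fun s => dh s i j - dphi s)) => // s sab.
      have /is_derive_mxP/(_ i j) ? := hE _ sab.
      have ? := phiE _ sab.
      exact: is_deriveB.
    by have /andP[] := dhij s i j (sW s sab); lra.
  by lra.
apply/mx_norm_leP; last by move=> i j; rewrite !mxE hij.
(* Nonnegativity of the bound is a separate goal: for a matrix without entries it does not follow
   from [hij]. *)
have : (- phi b) <= (- phi a).
  apply: (@le0_is_derive_le _ (fun s => - phi s) (fun s => - dphi s)) => // s sab.
    by have ? := phiE _ sab; exact: is_deriveN.
  by rewrite oppr_le0 (le_trans (normr_ge0 (dh s)))// le_dh// sW.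
by lra.
Qed.

(** * Global solutions of bounded Lipschitz fields *)

(** The integral from [- c] is a primitive only to the right of [- c]. Subtracting its value at 0
    removes the dependence on [c], which may then vary with [t]. *)
Lemma primitive_exists (R : realType) (u : R -> R) : continuous u ->
  exists2 U : R -> R, U 0 = 0 & forall t : R, is_derive t 1 U (u t).
Proof.
move=> cu.
pose F (c t : R) : R := \int[@lebesgue_measure R]_(s in `[- c, t]) u s.
have FE (c t : R) : - c < t -> is_derive t 1 (F c) (u t).
  move=> ct.
  have ui : (@lebesgue_measure R).-integrable `[- c, t + 1] (EFin \o u).
    apply: continuous_compact_integrable; first exact: segment_compact.
    exact: continuous_subspaceT.
  have tt1 : t < t + 1 by rewrite ltrDl.
  have [Fd Fu] := continuous_FTC1_closed tt1 ui ct (cu t).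
  by split => //; rewrite -derive1E.
(* The difference of the two primitives and its opposite both have derivative 0, so neither
   increases between 0 and [t]. *)
have F_indep (c c' t : R) : `|t| < c -> `|t| < c' -> F c t - F c 0 = F c' t - F c' 0.
  have [t0|t0] := leP 0 t => tc tc'; rewrite ?(ger0_norm t0) in tc tc'.
    have dE (s : R) : 0 <= s <= t -> is_derive s 1 (fun s => F c s - F c' s) 0.
      move=> /andP[s0 st]; rewrite -(subrr (u s)).
      by apply: is_deriveB; apply: FE; lra.
    have := le0_is_derive_le t0 dE (fun _ _ => lexx 0).
    have dE' (s : R) : 0 <= s <= t -> is_derive s 1 (fun s => F c' s - F c s) 0.
      move=> /andP[s0 st]; rewrite -(subrr (u s)).
      by apply: is_deriveB; apply: FE; lra.
    have := le0_is_derive_le t0 dE' (fun _ _ => lexx 0).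
    by lra.
  rewrite !(ltr0_norm t0) in tc tc'.
  have dE (s : R) : t <= s <= 0 -> is_derive s 1 (fun s => F c s - F c' s) 0.
    move=> /andP[s0 st]; rewrite -(subrr (u s)).
    by apply: is_deriveB; apply: FE; lra.
  have := le0_is_derive_le (ltW t0) dE (fun _ _ => lexx 0).
  have dE' (s : R) : t <= s <= 0 -> is_derive s 1 (fun s => F c' s - F c s) 0.
    move=> /andP[s0 st]; rewrite -(subrr (u s)).
    by apply: is_deriveB; apply: FE; lra.
  have := le0_is_derive_le (ltW t0) dE' (fun _ _ => lexx 0).
  by lra.
exists (fun t => F (`|t| + 1) t - F (`|t| + 1) 0); first by rewrite subrr.
move=> t; pose c := `|t| + 1.
(* Near [t] the varying constant can be frozen at [c], because [|s| < c] there. *)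
apply: (@near_eq_is_derive _ _ _ (fun s => F c s - F c 0)).
  near=> s; apply: F_indep; last by rewrite ltrDl.
  by near: s; apply: cvgr_norm_lt; [exact: cvg_id|rewrite ltrDl].
rewrite -(subr0 (u t)).
have ? : is_derive t 1 (F c) (u t).
  by apply: FE; rewrite /c ltrNl (le_lt_trans (ler_norm _))// normrN ltrDl.
exact: is_deriveB.
Unshelve. all: by end_near. Qed.

Lemma primitive_cV_exists (R : realType) (n : nat) (p : 'cV[R]_n)
    (u : R -> 'cV[R]_n) : continuous u ->
  exists2 U : R -> 'cV[R]_n, U 0 = p & forall t : R, is_derive t 1 U (u t).
Proof.
move=> cu.
have /choice[U UE] i : exists U : R -> R,
    U 0 = 0 /\ forall t : R, is_derive t 1 U (u t i 0).
  have [|U U0 UE] := @primitive_exists R (fun t => u t i 0); last by exists U.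
  move=> t; apply: (@continuous_comp _ _ _ u (fun M : 'cV[R]_n => M i 0)).
    exact: cu.
  exact: coord_continuous.
exists (fun t => \col_i (p i 0 + U i t)).
  by apply/matrixP => i j; rewrite !mxE (UE i).1 addr0 ord1.
move=> t; apply/is_derive_mxP => i j.
rewrite (_ : (fun s => _) = (fun s => p i 0 + U i s)); last first.
  by apply/funext => s; rewrite !mxE.
rewrite ord1 -(add0r (u t i 0)).
have ? := (UE i).2 t.
exact: is_deriveD.
Qed.

Lemma is_derive_expR_scale (R : realType) (K b t : R) :
  is_derive t 1 (fun s => K * expR (b * s)) (K * b * expR (b * t)).
Proof.
apply: is_derive_eq.
rewrite /GRing.scale /=; ring.
Qed.

Lemma lipschitz_continuous (R : realType) (V W : normedModType R) (g : V -> W)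
    (L : R) : (forall a b, `|g a - g b| <= L * `|a - b|) -> continuous g.
Proof.
move=> g_lip a; apply/cvgrPdist_le => e e0; near=> b.
(* No sign is assumed for [L]; [|L| + 1] is a positive Lipschitz constant. *)
have L10 : 0 < `|L| + 1 by rewrite ltr_wpDl.
rewrite (le_trans (g_lip _ _))// (@le_trans _ _ ((`|L| + 1) * `|a - b|))//.
  by rewrite ler_wpM2r// (le_trans (ler_norm _))// lerDl.
rewrite mulrC -ler_pdivlMr//; near: b.
have /cvgrPdist_le/(_ (e / (`|L| + 1))) := @cvg_id _ (nbhs a); apply.
by rewrite divr_gt0.
Unshelve. all: by end_near. Qed.

(* With [dphi] a multiple of [expR (b * s)], integrating gains the factor
   [b^-1]: for [b = 2 * L] this makes the Picard operator of an [L]-Lipschitz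
   field a contraction on the whole line. *)
Lemma is_derive_expR_dominated (R : realType) (m n : nat)
    (h dh : R -> 'M[R]_(m, n)) (K b : R) :
  (forall s : R, is_derive s 1 h (dh s)) ->
  (forall s : R, `|dh s| <= K * b * expR (b * `|s|)) ->
  forall t : R, `|h t - h 0| <= K * expR (b * `|t|) - K.
Proof.
move=> hE le_dh t; have [t0|t0] := leP 0 t.
  have -> : K * expR (b * `|t|) - K = K * expR (b * t) - K * expR (b * 0).
    by rewrite ger0_norm// mulr0 expR0 mulr1.
  apply: (@is_derive_dominated _ _ _ h dh (fun s => K * expR (b * s))
    (fun s => K * b * expR (b * s))) => // s => [_|/andP[s0 _]].
  - exact: is_derive_expR_scale.
  - by rewrite -{2}(ger0_norm s0).
have {}t0 : 0 <= - t by rewrite oppr_ge0 ltW.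
(* Negative times are reduced to positive ones by reflecting [s] to [- s]. *)
have := @is_derive_dominated _ _ _ (fun s => h (- 1 * s + 0))
  (fun s => (- 1) *: dh (- 1 * s + 0)) (fun s => K * expR (b * s))
  (fun s => K * b * expR (b * s)) 0 (- t) t0.
rewrite !mulr0 !addr0 mulN1r opprK expR0 mulr1 ler0_norm -?oppr_ge0//; apply=> s.
- by move=> _; exact: is_derive_affine.
- by move=> _; exact: is_derive_expR_scale.
- move=> /andP[s0 _]; rewrite scaleN1r normrN (le_trans (le_dh _))//.
  by rewrite addr0 mulN1r normrN ger0_norm.
Qed.

(** Picard iteration on the whole line at once: measured against the weight [expR (2 * L * |t|)],
    the Picard operator halves distances, so no local solutions have to be glued. *)
Lemma global_solution_exists (R : realType) (n : nat)
    (g : 'cV[R]_n -> 'cV[R]_n) (L M : R) : 0 < L ->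
  (forall a b, `|g a - g b| <= L * `|a - b|) -> (forall a, `|g a| <= M) ->
  forall p, exists2 y : R -> 'cV[R]_n,
    y 0 = p & forall t : R, is_derive t 1 y (g (y t)).
Proof.
move=> L0 g_lip g_le p.
have cg : continuous g by exact: lipschitz_continuous g_lip.
have M0 : 0 <= M := le_trans (normr_ge0 _) (g_le 0).
have lip_continuous (y : R -> 'cV[R]_n) :
    (forall s t, s <= t -> `|y t - y s| <= M * t - M * s) -> continuous y.
  move=> y_lip.
  have {}y_lip s t : `|y s - y t| <= M * `|s - t|.
    have [st|/ltW ts] := leP s t.
      by rewrite distrC (le_trans (y_lip _ _ st))// ler0_norm ?subr_le0//; lra.
    by rewrite (le_trans (y_lip _ _ ts))// ger0_norm ?subr_ge0//; lra.
  exact: lipschitz_continuous y_lip.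
(* [P] is the Picard operator; its value at a discontinuous curve is arbitrary. *)
have /choice[P PE] : forall y : R -> 'cV[R]_n, exists z : R -> 'cV[R]_n,
    continuous y -> z 0 = p /\ forall t : R, is_derive t 1 z (g (y t)).
  move=> y; have [cy|?] := pselect (continuous y); last by exists (cst p).
  have [|z] := @primitive_cV_exists R n p (g \o y); last by exists z.
  by move=> t; apply: continuous_comp; [exact: cy|exact: cg].
have P_lip : forall y : R -> 'cV[R]_n, continuous y ->
    forall s t, s <= t -> `|P y t - P y s| <= M * t - M * s.
  move=> y cy s t st.
  apply: (@is_derive_dominated _ _ _ _ (g \o y) ( *%R M) (cst M)) => // u _.
  - exact: (PE y cy).2.
  - have -> : *%R M = M *: id :> (R -> R) by [].
    by apply: is_derive_eq; rewrite /GRing.scale/= mulr1.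
  - exact: g_le.
have P_contract : forall (y z : R -> 'cV[R]_n) (C : R),
    continuous y -> continuous z ->
    (forall t, `|y t - z t| <= C * expR (2 * L * `|t|)) ->
    forall t, `|P y t - P z t| <= C / 2 * expR (2 * L * `|t|).
  move=> y z C cy cz yz t.
  have C0 : 0 <= C.
    by have := le_trans (normr_ge0 _) (yz 0); rewrite pmulr_lge0// expR_gt0.
  have := @is_derive_expR_dominated _ _ _ (fun t => P y t - P z t)
    (fun t => g (y t) - g (z t)) (C / 2) (2 * L) _ _ t.
  rewrite (PE y cy).1 (PE z cz).1 subrr subr0 => H.
  have {}H := le_trans (H _ _); apply: H => [s|s|].
  - have ? := (PE y cy).2 s; have ? := (PE z cz).2 s.
    exact: is_deriveB.
  - rewrite (le_trans (g_lip _ _))// (le_trans (ler_wpM2l (ltW L0) (yz s)))//.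
    by rewrite le_eqVlt; apply/orP; left; apply/eqP; field.
  - by rewrite gerBl divr_ge0.
pose x k := iter k P (cst p).
have x_cont k : continuous (x k).
  elim: k => [|k IH]; first by move=> t; exact: cvg_cst.
  exact/lip_continuous/P_lip.
have x_lip k s t : s <= t -> `|x k t - x k s| <= M * t - M * s.
  move=> st; case: k => [|k]; last exact: P_lip.
  by rewrite subrr normr0 -mulrBr mulr_ge0// subr_ge0.
(* Chosen so that [M * |t| = C * (2 * L * |t|)]; since an exponential dominates its exponent, [C]
   times the weight bounds the first Picard step. *)
pose C := M / (2 * L).
pose E (t : R) := expR (2 * L * `|t|).
have x01 t : `|x 1%N t - x 0%N t| <= C * E t.
  have xt0 : `|x 1%N t - x 0%N t| <= M * `|t|.
    rewrite /x /= -[p in _ - cst p t](PE _ (x_cont 0%N)).1.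
    have [t0|/ltW t0] := leP 0 t.
      by rewrite (le_trans (P_lip _ (x_cont 0%N) _ _ t0))// ger0_norm// mulr0 subr0.
    rewrite distrC (le_trans (P_lip _ (x_cont 0%N) _ _ t0))// ler0_norm//.
    by rewrite mulr0 sub0r mulrN.
  rewrite (le_trans xt0)// (_ : M * `|t| = C * (2 * L * `|t|)).
    rewrite ler_wpM2l ?divr_ge0 ?mulr_ge0 ?(ltW L0)//.
    by rewrite (le_trans _ (expR_ge1Dx _))// lerDr.
  by rewrite /C; field; rewrite gt_eqF.
have xS k t : `|x k.+1 t - x k t| <= C / 2 ^+ k * E t.
  elim: k t => [|k IH] t; first by rewrite expr0 divr1.
  have -> : C / 2 ^+ k.+1 = C / 2 ^+ k / 2 by rewrite exprS; field; rewrite expf_neq0.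
  exact: (P_contract _ _ _ (x_cont k.+1) (x_cont k)).
have C0 : 0 <= C by rewrite divr_ge0// mulr_ge0// ltW.
have x_cauchy k m t : `|x (k + m)%N t - x k t| <= 2 * C / 2 ^+ k * E t.
  (* Keeping the remainder of the geometric series makes the bound telescope, so that the induction
     on [m] closes. *)
  suff : `|x (k + m)%N t - x k t| <= (2 * C / 2 ^+ k - 2 * C / 2 ^+ (k + m)) * E t.
    move=> /le_trans; apply; rewrite ler_wpM2r ?expR_ge0// gerBl.
    by rewrite divr_ge0// mulr_ge0.
  elim: m => [|m IH]; first by rewrite addn0 !subrr normr0 mul0r.
  rewrite -(subrK (x (k + m)%N t) (x (k + m.+1)%N t)) -addrA.
  rewrite (le_trans (ler_normD _ _))// addnS.
  rewrite (le_trans (lerD (xS _ _) IH))// -mulrDl ler_wpM2r ?expR_ge0//.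
  rewrite le_eqVlt; apply/orP; left; apply/eqP; rewrite exprS; field.
  by rewrite !expf_neq0.
have cvg0 t : 2 * C / 2 ^+ k * E t @[k --> \oo] --> (0 : R).
  rewrite [X in _ --> X](_ : 0 = 2 * C * 0 * E t); last by rewrite mulr0 mul0r.
  apply: cvgMl; apply: cvgMr.
  under eq_fun do rewrite -exprVn.
  by apply: cvg_expr; rewrite ger0_norm ?invr_ge0// invf_lt1// ltr1n.
have x_cvg t : cvgn (fun k => x k t).
  apply/cauchy_cvgP/cauchy_exP => e e0.
  have /cvgrPdist_lt/(_ e e0)[k _ /(_ k (leqnn k))] := cvg0 t.
  rewrite /= sub0r normrN ger0_norm; last first.
    by rewrite mulr_ge0 ?expR_ge0// divr_ge0// mulr_ge0.
  move=> ke; exists (x k t), k => // m /= km.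
  by rewrite -ball_normE /= distrC -(subnKC km) (le_lt_trans (x_cauchy _ _ _)).
pose y (t : R) : 'cV[R]_n := lim (x k t @[k --> \oo]).
have xy t : x k t @[k --> \oo] --> y t := x_cvg t.
have y_le k t : `|y t - x k t| <= 2 * C / 2 ^+ k * E t.
  have : `|x m t - x k t| @[m --> \oo] --> `|y t - x k t|.
    by apply: cvg_norm; apply: cvgB; [exact: xy|exact: cvg_cst].
  move=> /cvg_lim <- //; apply: limr_le.
    apply: is_cvg_norm; apply: is_cvgB; [exact: x_cvg|exact: is_cvg_cst].
  by near=> m; rewrite -(@subnKC k m) //; near: m; exists k.
have y_cont : continuous y.
  apply: lip_continuous => s t st.
  have : `|x k t - x k s| @[k --> \oo] --> `|y t - y s|.
    by apply: cvg_norm; apply: cvgB; exact: xy.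
  move=> /cvg_lim <- //; apply: limr_le.
    by apply: is_cvg_norm; apply: is_cvgB; exact: x_cvg.
  by near=> k; exact: x_lip.
(* Both [P y] and [y] lie within [C / 2 ^+ k] times the weight of [x k.+1], for every [k]. *)
have Py : P y = y.
  apply/funext => t; apply/eqP; rewrite -subr_eq0 -normr_le0.
  rewrite -(cvg_lim _ (cvg0 t))//; apply: limr_ge; first exact: cvgP (cvg0 t).
  near=> k; rewrite -(subrK (x k.+1 t) (P y t)) -addrA (le_trans (ler_normD _ _))//.
  have P_le : `|P y t - x k.+1 t| <= 2 * C / 2 ^+ k / 2 * E t.
    exact: (P_contract _ _ _ y_cont (x_cont k) (y_le k)).
  have := y_le k.+1 t; rewrite distrC => /(lerD P_le)/le_trans; apply.
  rewrite -mulrDl ler_wpM2r ?expR_ge0// le_eqVlt; apply/orP; left; apply/eqP.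
  by rewrite exprS; field; rewrite expf_neq0.
have [Py0 PyE] := PE y y_cont.
by exists y => [|t]; rewrite -{1}Py.
Unshelve. all: by end_near.
Qed.

(** * Gronwall estimates and truncation *)

(** The norm need not be differentiable, so the weighted norm [u] is maximised instead, at some [c].
    Integrating [|dh s| <= L * u c * expR (2 * L * s)] up to [c] gains a factor 1/2, which lets the
    term in [u c] be absorbed and bounds [u c] by the initial value. *)
Lemma gronwall (R : realType) (m n : nat) (h dh : R -> 'M[R]_(m, n)) (L t : R) :
  0 < L -> 0 <= t -> (forall s, 0 <= s <= t -> is_derive s 1 h (dh s)) ->
  (forall s, 0 <= s <= t -> `|dh s| <= L * `|h s|) ->
  `|h t| <= 2 * `|h 0| * expR (2 * L * t).
Proof.
move=> L0 t0 hE le_dh; pose u s := `|h s| * expR (- (2 * L * s)).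
have u_cont : {within `[0, t], continuous u}.
  apply: continuous_in_subspaceT => s; rewrite inE/= in_itv/= => s0t.
  apply: (@continuousM _ _ (fun s => `|h s|) (fun s => expR (- (2 * L * s)))).
    apply: (@continuous_comp _ _ _ h (fun z => `|z|)); last exact: norm_continuous.
    exact: is_derive_continuous (hE s s0t).
  apply: (@continuous_comp _ _ _ (fun s => - (2 * L * s)) expR).
    apply: (@continuousN _ _ _ ( *%R (2 * L)) s).
    exact: mulrl_continuous.
  exact: continuous_expR.
have [c + cmax] := EVT_max t0 u_cont; rewrite in_itv/= => /andP[c0 ct].
have le_h s : 0 <= s <= t -> `|h s| <= u c * expR (2 * L * s).
  move=> s0t; rewrite -ler_pdivrMr ?expR_gt0// -expRN; apply: cmax.
  by rewrite in_itv.
have s0c0t s : 0 <= s <= c -> 0 <= s <= t.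
  by move=> /andP[-> /le_trans]; apply.
have hc : `|h c| = u c * expR (2 * L * c).
  by rewrite /u -mulrA -expRD addNr expR0 mulr1.
have uc0 : 0 <= u c by rewrite mulr_ge0// expR_ge0.
have : `|h c - h 0| <= u c / 2 * expR (2 * L * c) - u c / 2 * expR (2 * L * 0).
  apply: (@is_derive_dominated _ _ _ h dh
    (fun s => u c / 2 * expR (2 * L * s))
    (fun s => u c / 2 * (2 * L) * expR (2 * L * s))) => // s /s0c0t sc.
  - exact: hE.
  - exact: is_derive_expR_scale.
  - rewrite (le_trans (le_dh _ sc))// (le_trans (ler_wpM2l (ltW L0) (le_h s sc)))//.
    by rewrite le_eqVlt; apply/orP; left; apply/eqP; field.
rewrite mulr0 expR0 mulr1 => h_dom.
have uc_le : u c <= 2 * `|h 0|.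
  have Ec : 1 <= expR (2 * L * c).
    by rewrite (le_trans _ (expR_ge1Dx _))// lerDl mulr_ge0// mulr_ge0// ltW.
  have := lerB_dist (h c) (h 0); rewrite hc; nra.
rewrite (le_trans (le_h t _)) ?t0 ?lexx//.
by rewrite ler_wpM2r// expR_ge0.
Qed.

(** [K] need not be convex, so local constants cannot be chained along segments. Instead pairs in
    the compact product of [K] with itself are considered: near the diagonal a local constant
    serves, and elsewhere the difference quotient is bounded since its denominator stays away from
    0. *)
Lemma locally_lipschitz_compact (R : realType) (V W : normedModType R)
    (f : V -> W) (K : set V) : compact K ->
  (forall x, K x -> exists2 U, nbhs x U & [lipschitz f z | z in U]) ->
  exists2 L : R, 0 < L &
    forall a b, K a -> K b -> `|f a - f b| <= L * `|a - b|.
Proof.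
move=> cK f_lip.
have f_cont x : K x -> f z @[z --> x] --> f x.
  move=> Kx; have [U xU] := f_lip x Kx.
  rewrite /lipschitz_on; case/(@filter_ex _ _ _ _ ) => M UM.
  apply/cvgrPdist_le => e e0; near=> z.
  have -> : `|f x - f z| <= e; last by [].
  have zU : U z by near: z.
  have /= := UM (x, z) (conj (nbhs_singleton xU) zU).
  move=> /le_trans; apply.
  rewrite (@le_trans _ _ ((`|M| + 1) * `|x - z|))//.
    by rewrite ler_wpM2r// (le_trans (ler_norm _))// lerDl.
  rewrite mulrC -ler_pdivlMr ?ltr_wpDl//; near: z.
  have /cvgrPdist_le/(_ (e / (`|M| + 1))) := @cvg_id _ (nbhs x); apply.
  by rewrite divr_gt0// ltr_wpDl.
(* With [C] tending to [+oo], it suffices that each pair has a neighbourhood on which all large [C]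
   are Lipschitz constants. *)
have /compact_near_coveringP/(_ R (pinfty_nbhs R)
  (fun C ab => `|f ab.1 - f ab.2| <= C * `|ab.1 - ab.2|)) := compact_setX cK cK.
move=> /(_ _)[].
- move=> [a b] [/= Ka Kb].
  have [<-{b Kb}|ab] := eqVneq a b.
    have [U aU UC] := f_lip a Ka.
    exists (U `*` U, [set C | C.-lipschitz_U f]); first by split => //; exists (U, U).
    by move=> [[x y] C] [/= [Ux Uy]] /(_ (x, y)); exact.
  have d0 : 0 < `|a - b| / 4 by rewrite divr_gt0// normr_gt0 subr_eq0.
  have near_fst (P : set V) : nbhs a P -> \forall z \near (a, b), P z.1.
    by move=> aP; exists (P, setT) => [|[x y] []//]; split=> //; exact: filterT.
  have near_snd (P : set V) : nbhs b P -> \forall z \near (a, b), P z.2.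
    by move=> bP; exists (setT, P) => [|[x y] []//]; split=> //; exact: filterT.
  near=> z C => /=.
  have z1 : `|a - z.1| <= `|a - b| / 4.
    near: z; apply: (near_fst [set x | `|a - x| <= `|a - b| / 4]).
    by have /cvgrPdist_le/(_ _ d0) := @cvg_id _ (nbhs a).
  have z2 : `|b - z.2| <= `|a - b| / 4.
    near: z; apply: (near_snd [set x | `|b - x| <= `|a - b| / 4]).
    by have /cvgrPdist_le/(_ _ d0) := @cvg_id _ (nbhs b).
  have fz1 : `|f a - f z.1| <= 1.
    near: z; apply: (near_fst [set x | `|f a - f x| <= 1]).
    by have /cvgrPdist_le/(_ _ ltr01) := f_cont a Ka.
  have fz2 : `|f b - f z.2| <= 1.
    near: z; apply: (near_snd [set x | `|f b - f x| <= 1]).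
    by have /cvgrPdist_le/(_ _ ltr01) := f_cont b Kb.
  (* The threshold is the upper bound [f_le] for the numerator over the lower bound [ab_le] for the
     denominator. *)
  have C_ge : (`|f a - f b| + 2) / (`|a - b| / 4) <= C.
    by near: C; apply: nbhs_pinfty_ge; rewrite num_real.
  have ab_le : `|a - b| / 4 <= `|z.1 - z.2|.
    have := ler_distD z.1 a b; have := ler_distD z.2 z.1 b.
    by rewrite (distrC z.2 b); lra.
  have f_le : `|f z.1 - f z.2| <= `|f a - f b| + 2.
    have := ler_distD (f a) (f z.1) (f z.2); have := ler_distD (f b) (f a) (f z.2).
    by rewrite (distrC (f z.1) (f a)); lra.
  rewrite (le_trans f_le)// (@le_trans _ _ (C * (`|a - b| / 4)))//.
    by rewrite -ler_pdivrMr.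
  by rewrite ler_wpM2l// (le_trans _ C_ge)// divr_ge0 ?(ltW d0)// addr_ge0.
- move=> M [_ MC]; exists (`|M| + 1) => [|a b Ka Kb]; first by rewrite ltr_wpDl.
  have /MC/(_ (a, b)) : M < `|M| + 1.
    by rewrite (le_lt_trans (ler_norm _))// ltrDl.
  by apply.
Unshelve. all: by end_near. Qed.

(** Heine-Borel for row vectors, carried over by transposition, which does not increase the norm. *)
Lemma compact_cV_ball (R : realType) (n : nat) (r : R) :
  compact [set a : 'cV[R]_n | `|a| <= r].
Proof.
have tr_le (m k : nat) (a : 'M[R]_(m, k)) : `|a^T| <= `|a|.
  by apply/mx_norm_leP => // i j; rewrite mxE mx_norm_entry.
have -> : [set a : 'cV[R]_n | `|a| <= r] = trmx @` [set a : 'rV[R]_n | `|a| <= r].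
  apply/seteqP; split=> [a ar|_ [a ar <-]] /=; last exact: le_trans (tr_le _ _ _) ar.
  by exists a^T; rewrite /= ?trmxK// (le_trans (tr_le _ _ _)).
apply: continuous_compact.
  apply/continuous_subspaceT/(@lipschitz_continuous _ _ _ _ 1) => a b.
  by rewrite mul1r -linearB tr_le.
apply: bounded_closed_compact.
  by exists r; split => [|M rM a /= ar]; [exact: num_real|rewrite (le_trans ar) ?ltW].
apply: (@closed_comp _ _ (fun a : 'rV[R]_n => `|a|) [set x | x <= r]).
  by move=> a _; exact: norm_continuous.
exact: closed_le.
Qed.

(** Clamping is 1-Lipschitz for the max norm and takes its values in a compact ball, on which a
    single Lipschitz constant serves for [f]. *)
Lemma truncation_exists (R : realType) (n : nat) (f : 'cV[R]_n -> 'cV[R]_n)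
    (r : R) : locally_lipschitz f -> 0 <= r ->
  exists g : 'cV[R]_n -> 'cV[R]_n, exists L M : R,
    [/\ 0 < L, forall a b, `|g a - g b| <= L * `|a - b|,
        forall a, `|g a| <= M & forall a, `|a| <= r -> g a = f a].
Proof.
move=> f_lip r0.
pose clamp (a : 'cV[R]_n) : 'cV[R]_n := \col_i Num.max (- r) (Num.min r (a i 0)).
have clamp_le a : `|clamp a| <= r.
  apply/mx_norm_leP => // i j; rewrite mxE ler_norml.
  by rewrite le_max lexx/= ge_max ge_min lexx/= andbT; lra.
have clampE a : `|a| <= r -> clamp a = a.
  move=> /mx_norm_leP -/(_ r0) ar; apply/matrixP => i j; rewrite mxE.
  have := ar i j; rewrite ord1 ler_norml => /andP[? ?].
  by rewrite min_r// max_r.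
have clamp_lip a b : `|clamp a - clamp b| <= `|a - b|.
  apply/mx_norm_leP => // i j; apply: le_trans (mx_norm_entry _ i j).
  rewrite !mxE !ord1; move: (a i 0) (b i 0) => {i j} x y.
  wlog xy : x y / x <= y => [clamp_xy|].
    have [|/ltW] := leP x y; first exact: clamp_xy.
    by rewrite distrC (distrC x); exact: clamp_xy.
  rewrite (distrC x) (ger0_norm (_ : 0 <= y - x)) ?subr_ge0// ler_norml.
  have /max_r rE : - r <= r by lra.
  case: (leP r x) => ?; case: (leP r y) => ?; rewrite ?rE;
    by case: (leP (- r) x) => ?; case: (leP (- r) y) => ?; lra.
have [L L0 fL] := @locally_lipschitz_compact _ _ _ f _ (@compact_cV_ball R n r)
  (fun x _ => f_lip x).
(* The bound on the field comes from comparing [f (clamp a)] with [f 0]. *)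
exists (f \o clamp), L, (`|f 0| + L * r); split => //= [a b|a|a /clampE->//].
  by rewrite (le_trans (fL _ _ (clamp_le a) (clamp_le b)))// ler_wpM2l// ltW.
rewrite -[f _](subrK (f 0)) addrC (le_trans (ler_normD _ _))// lerD2l.
rewrite (le_trans (fL _ 0 (clamp_le a) _)) ?subr0 /= ?normr0//.
by rewrite ler_wpM2l// ltW.
Qed.

(** * Maximal solutions *)

Lemma interval_sg_scale (R : realType) (J : set R) (t s : R) :
  is_interval J -> J 0 -> J t -> 0 <= s <= `|t| -> J (Num.sg t * s).
Proof.
move=> Ji J0 Jt /andP[s0 st].
have [t0|t0|t0] := ltgtP t 0; last by rewrite t0 sgr0 mul0r.
  rewrite ltr0_norm// in st; rewrite ltr0_sg// mulN1r.
  by apply: (Ji t 0) => //; apply/andP; split; lra.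
rewrite gtr0_norm// in st; rewrite gtr0_sg// mul1r.
by apply: (Ji 0 t) => //; rewrite s0.
Qed.

(** Between 0 and [t] both solutions stay in a common ball, where [f] is Lipschitz; the Gronwall
    estimate applies to their difference, which vanishes at time 0. *)
Lemma ivp_solution_unique (R : realType) (n : nat) (f : 'cV[R]_n -> 'cV[R]_n)
    (p : 'cV[R]_n) (K1 K2 : set R) (y1 y2 : R -> 'cV[R]_n) :
  locally_lipschitz f -> ivp_solution f p K1 y1 -> ivp_solution f p K2 y2 ->
  forall t, K1 t -> K2 t -> y1 t = y2 t.
Proof.
move=> f_lip [_ K1i K10 y10 y1E] [_ K2i K20 y20 y2E] t K1t K2t.
(* [e * s] runs from 0 to [t] as [s] runs from 0 to [|t|], on whichever side of 0 the time [t]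
   lies. *)
pose e := Num.sg t.
have zE (y : R -> 'cV[R]_n) (K : set R) : is_interval K -> K 0 -> K t ->
    (forall s, K s -> is_derive s 1 y (f (y s))) -> forall s : R, 0 <= s <= `|t| ->
    is_derive s 1 (fun s => y (e * s + 0)) (e *: f (y (e * s + 0))).
  move=> Ki K0 Kt yE s st; apply: is_derive_affine; apply: yE.
  by rewrite addr0; exact: interval_sg_scale.
have z1E := zE _ _ K1i K10 K1t y1E; have z2E := zE _ _ K2i K20 K2t y2E.
have z_le (y : R -> 'cV[R]_n) :
    (forall s : R, 0 <= s <= `|t| ->
      is_derive s 1 (fun s => y (e * s + 0)) (e *: f (y (e * s + 0)))) ->
    exists r, forall s : R, 0 <= s <= `|t| -> `|y (e * s + 0)| <= r.
  move=> yE.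
  have yc : {within `[0, `|t|], continuous (fun s => `|y (e * s + 0)|)}.
    apply: continuous_in_subspaceT => s; rewrite inE/= in_itv/= => st.
    apply: (@continuous_comp _ _ _ (fun s => y (e * s + 0)) (fun z => `|z|)).
      exact: is_derive_continuous (yE s st).
    exact: norm_continuous.
  have [c _ cmax] := EVT_max (normr_ge0 t) yc.
  by exists `|y (e * c + 0)| => s st; apply: cmax; rewrite in_itv.
have [r1 y1r] := z_le _ z1E; have [r2 y2r] := z_le _ z2E.
have [L L0 fL] := @locally_lipschitz_compact _ _ _ f _
  (@compact_cV_ball R n (Num.max r1 r2)) (fun x _ => f_lip x).
have hE s : 0 <= s <= `|t| -> is_derive s 1
    (fun s : R => y1 (e * s + 0) - y2 (e * s + 0))
    (e *: f (y1 (e * s + 0)) - e *: f (y2 (e * s + 0))).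
  by move=> st; have ? := z1E s st; have ? := z2E s st; exact: is_deriveB.
have := gronwall L0 (normr_ge0 t) hE.
rewrite !mulr0 !addr0 y10 y20 subrr normr0 mulr0 mul0r -numEsg.
rewrite normr_le0 subr_eq0 => H.
apply/eqP/H => s st.
rewrite -scalerBr normrZ (@le_trans _ _ (1 * `|f (y1 (e * s + 0)) - f (y2 (e * s + 0))|))//.
  by rewrite ler_wpM2r// normr_sg; case: (t != 0).
by rewrite mul1r fL//= le_max ?y1r ?y2r// orbT.
Qed.

Lemma ivp_solution_local (R : realType) (n : nat) (f : 'cV[R]_n -> 'cV[R]_n)
    (p : 'cV[R]_n) :
  locally_lipschitz f -> exists K y, ivp_solution f p K y.
Proof.
(* The margin 1 keeps the solution of the truncated field inside the ball for a short time, by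
   continuity. *)
move=> f_lip; have r0 : 0 <= `|p| + 1 by rewrite addr_ge0.
have [g [L [M [L0 g_lip g_le gE]]]] := truncation_exists f_lip r0.
have [y y0 yE] := global_solution_exists L0 g_lip g_le p.
have yc : `|y t| @[t --> (0 : R)] --> `|p|.
  by apply: cvg_norm; rewrite -y0; exact: is_derive_continuous (yE 0).
have /cvgrPdist_lt/(_ 1 ltr01)[d d0 yd] := yc.
exists `]- d, d[%classic, y; split => //.
- exact: interval_is_interval.
- by rewrite /= in_itv/= oppr_lt0 d0.
- move=> t; rewrite /= in_itv/= -ltr_norml => td; rewrite -gE//.
  have := yd t; rewrite /= sub0r normrN distrC => /(_ td).
  by move=> /(le_lt_trans (ler_norm _)); rewrite ltrBlDl => /ltW.
Qed.

(** The domain is the union of the domains of all solutions; by uniqueness their values agree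
    wherever they overlap. *)
Lemma maximal_solution_exists (R : realType) (n : nat)
    (f : 'cV[R]_n -> 'cV[R]_n) (p : 'cV[R]_n) :
  locally_lipschitz f -> exists J x, the_ivp_solution f p J x.
Proof.
move=> f_lip; have [K0 [y0 sol0]] := ivp_solution_local p f_lip.
pose J := [set t : R | exists K y, ivp_solution f p K y /\ K t].
have /choice[x xE] : forall t, exists v, forall K y,
    ivp_solution f p K y -> K t -> y t = v.
  move=> t; have [[K [y [sol Kt]]]|nJ] := pselect (J t).
    by exists (y t) => K' y' sol' K't; exact: (ivp_solution_unique f_lip sol' sol).
  by exists 0 => K y sol Kt; exfalso; apply: nJ; exists K, y.
have near_sol t K y : ivp_solution f p K y -> K t -> \forall s \near t, K s.
  by move=> [Ko _ _ _ _] Kt; apply: open_nbhs_nbhs.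
exists J, x; split; last first.
  move=> K y sol; split => [t Kt|t Kt]; first by exists K, y.
  exact: (xE t K y).
split.
- rewrite openE => t [K [y [sol Kt]]].
  by apply: filterS (near_sol _ _ _ sol Kt) => s Ks; exists K, y.
(* [a] and [b] may come from different domains. Both contain 0, so [c] lies in one or the other
   according to its sign. *)
- move=> a b [K [y [sol Ka]]] [K' [y' [sol' K'b]]] c /andP[ac cb].
  have [_ Ki K0' _ _] := sol; have [_ Ki' K0'' _ _] := sol'.
  have [c0|c0] := leP 0 c.
    by exists K', y'; split => //; apply: (Ki' 0 b) => //; rewrite c0.
  by exists K, y; split => //; apply: (Ki a 0) => //; rewrite ac ltW.
- by exists K0, y0; split => //; case: sol0.
- by have [_ _ K00 y00 _] := sol0; rewrite -(xE _ _ _ sol0 K00).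
- move=> t [K [y [sol Kt]]].
  apply: (@near_eq_is_derive _ _ _ y).
    by apply: filterS (near_sol _ _ _ sol Kt) => s Ks; exact: xE sol Ks.
  by rewrite -(xE t K y sol Kt); case: sol => _ _ _ _; exact.
Qed.

(** * Trapping *)

Lemma compact_itv_preimage (R : realType) (phi : R -> R) (a b : R) (D : set R) :
  continuous phi -> closed D -> compact (`[a, b]%classic `&` phi @^-1` D).
Proof.
move=> phic Dc; apply: compact_closedI; first exact: segment_compact.
exact: closed_comp.
Qed.

(** [v] is the greatest element of the compact set of times in [[a, b]] where [phi <= c]. *)
Lemma last_time_le (R : realType) (phi : R -> R) (a b c : R) :
  a <= b -> continuous phi -> phi a <= c -> c < phi b ->
  exists2 v, a <= v < b & phi v <= c /\ forall s, v < s <= b -> c < phi s.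
Proof.
move=> ab phic ac cb; pose S := `[a, b]%classic `&` phi @^-1` [set x | x <= c].
have Sa : S !=set0 by exists a; split; rewrite //= in_itv/= lexx ab.
have [v] := @compact_EVT_max _ _ id S Sa
  (compact_itv_preimage phic (@closed_le R c))
  (continuous_subspaceT (fun=> cvg_id)).
rewrite inE => -[/=]; rewrite in_itv/= => /andP[av vb] vc vmax.
exists v; first by rewrite av lt_neqAle vb andbT; apply: contraTneq cb => <-; rewrite -leNgt.
split=> // s /andP[vs sb]; rewrite ltNge; apply/negP => sc.
have /vmax : s \in S.
  by rewrite inE; split; rewrite //= in_itv/= sb (le_trans av (ltW vs)).
by rewrite leNgt vs.
Qed.

(** Bootstrap: if [phi] reached [r], then no later than the first such time it would take the value
    [(r0 + r) / 2], having stayed below [r] until then; the hypothesis would force that value down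
    to [r0]. *)
Lemma continuation_bound (R : realType) (phi : R -> R) (r0 r : R) :
  continuous phi -> r0 < r -> phi 0 <= r0 ->
  (forall t, 0 <= t -> (forall s, 0 <= s <= t -> phi s <= r) -> phi t <= r0) ->
  forall t, 0 <= t -> phi t <= r0.
Proof.
move=> phic r0r phi0 phi_le t t0; rewrite leNgt; apply/negP => r0t.
pose S := `[0, t]%classic `&` phi @^-1` [set x | r <= x].
have [SN|S0] := pselect (S !=set0).
  have [v] := @compact_EVT_min _ _ id S SN
    (compact_itv_preimage phic (@closed_ge R r))
    (continuous_subspaceT (fun=> cvg_id)).
  rewrite inE => -[/=]; rewrite in_itv/= => /andP[v0 vt] rv vmin.
  have [||c] := @IVT _ phi 0 v ((r0 + r) / 2) v0.
  - exact: continuous_subspaceT.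
  - have r0v : phi 0 <= phi v by lra.
    by rewrite (min_idPl r0v) (max_idPr r0v); apply/andP; split; lra.
  rewrite in_itv/= => /andP[c0 cv] phic_eq.
  have : phi c <= r0.
    apply: phi_le => // s /andP[s0 sc]; rewrite leNgt; apply/negP => rs.
    have /vmin : s \in S.
      by rewrite inE; split; rewrite /= ?in_itv/= ?s0 ?(ltW rs)//; lra.
    move=> vs; have vc : v = c by apply/eqP; rewrite eq_le; apply/andP; split; lra.
    by move: phic_eq rv; rewrite vc; lra.
  by rewrite phic_eq; lra.
suff : phi t <= r0 by rewrite leNgt r0t.
apply: phi_le => // s st; rewrite leNgt; apply/negP => rs.
by apply: S0; exists s; split; rewrite //= ?in_itv// ltW.
Qed.

Lemma is_derive_lyapunov_le (R : realType) (n : nat)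
    (f : 'cV[R]_n -> 'cV[R]_n) (V : 'cV[R]_n -> R) (x : R -> 'cV[R]_n) (a b : R) :
  (forall p, differentiable V p) -> a <= b ->
  (forall s, a <= s <= b -> is_derive s 1 x (f (x s))) ->
  (forall s, a < s < b -> grad_dot V f (x s) <= 0) -> V (x b) <= V (x a).
Proof.
move=> dV ab xE Vx.
apply: (@le0_is_derive_le _ (V \o x) (grad_dot V f \o x)) => // s sab.
by apply: is_derive_grad_dot => //; exact: xE.
Qed.

(** If [theta] ended above [c], then after the last time it was at most [c] the second alternative
    of the cover would hold, so [theta] could not have risen. *)
Lemma sublevel_forward_invariant (R : realType) (n : nat)
    (f : 'cV[R]_n -> 'cV[R]_n) (V theta : 'cV[R]_n -> R) (v c : R)
    (x : R -> 'cV[R]_n) (t : R) :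
  (forall p, differentiable V p) -> (forall p, differentiable theta p) ->
  (forall p, grad_dot V f p <= 0) ->
  (forall p, V p <= v -> theta p <= c \/ grad_dot theta f p <= 0) ->
  continuous x -> 0 <= t ->
  (forall s, 0 <= s <= t -> is_derive s 1 x (f (x s))) ->
  V (x 0) <= v -> theta (x 0) <= c -> V (x t) <= v /\ theta (x t) <= c.
Proof.
move=> dV dtheta V_le0 cover xc t0 xE Vx0 thetax0.
have Vx s : 0 <= s <= t -> V (x s) <= v.
  move=> /andP[s0 st]; apply: le_trans Vx0.
  apply: (@is_derive_lyapunov_le _ _ f V x 0 s) => // u /andP[u0 us].
  by apply: xE; rewrite u0 (le_trans us).
split; first by apply: Vx; rewrite t0 lexx.
rewrite leNgt; apply/negP => ct.
have tc : continuous (theta \o x).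
  move=> s; apply: continuous_comp; first exact: xc.
  exact: differentiable_continuous.
have [w /andP[w0 wt] [wc cs]] := last_time_le t0 tc thetax0 ct.
have : theta (x t) <= theta (x w).
  apply: (@is_derive_lyapunov_le _ _ f theta x w t) => // [|s /andP[ws st]|s /andP[ws st]].
  - exact: ltW.
  - by apply: xE; rewrite st (le_trans w0 ws).
  - case: (cover (x s)) => //; first by apply: Vx; rewrite (ltW st) (le_trans w0 (ltW ws)).
    by rewrite leNgt (cs s)// ws ltW.
by move: wc ct; rewrite /=; lra.
Qed.

(** Continuous dependence on the initial point in both time directions. The field is autonomous, so
    [x] may be restarted at any time [c]. *)
Lemma global_solution_dist (R : realType) (n : nat) (g : 'cV[R]_n -> 'cV[R]_n)
    (L : R) (x y : R -> 'cV[R]_n) : 0 < L ->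
  (forall a b, `|g a - g b| <= L * `|a - b|) ->
  (forall t : R, is_derive t 1 x (g (x t))) ->
  (forall t : R, is_derive t 1 y (g (y t))) ->
  forall c s, `|x (c + s) - y s| <= 2 * `|x c - y 0| * expR (2 * L * `|s|).
Proof.
move=> L0 g_lip xE yE c s; pose e := Num.sg s.
have hE (u : R) : is_derive u 1 (fun u : R => x (e * u + c) - y (e * u + 0))
    (e *: g (x (e * u + c)) - e *: g (y (e * u + 0))).
  by apply: is_deriveB; exact: is_derive_affine.
have := gronwall L0 (normr_ge0 s) (fun u _ => hE u).
rewrite !mulr0 !addr0 add0r -numEsg (addrC s); apply=> u _.
rewrite -scalerBr normrZ.
rewrite (@le_trans _ _ (1 * `|g (x (e * u + c)) - g (y (e * u + 0))|))//.
  by rewrite ler_wpM2r// normr_sg; case: (s != 0).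
by rewrite mul1r g_lip.
Qed.

(** * Limit sets *)

(** Replaces sequences by recurrence near [p]; conversely, times [t i >= i] at distance less than
    [1 / (i + 1)] from [p] form the sequence. *)
Lemma positive_limit_setP (R : realType) (n : nat) (x : R -> 'cV[R]_n)
    (p : 'cV[R]_n) :
  positive_limit_set x p <->
  forall e T : R, 0 < e -> exists2 t, T <= t & `|p - x t| < e.
Proof.
split=> [[t [ty xt]] e T e0|limp].
  have tT : \forall i \near \oo, T <= t i by apply: (cvgryPge _).1.
  have xe : \forall i \near \oo, `|p - x (t i)| < e.
    by move/cvgrPdist_lt : xt; exact.
  have [i [Ti xi]] := filter_ex (filterI tT xe).
  by exists (t i).
have /choice[t tE] : forall i : nat, exists t,
    i%:R <= t /\ `|p - x t| < i.+1%:R^-1.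
  by move=> i; have [|t] := limp i.+1%:R^-1 i%:R; [by []|exists t].
exists t; split.
  apply/cvgryPge => T; near=> i; apply: le_trans (tE i).1.
  by near: i; exact: nbhs_infty_ger.
apply/cvgrPdist_lt => e e0; near=> i; apply: lt_trans (tE i).2 _.
by near: i; exact: near_infty_natSinv_lt (PosNum e0).
Unshelve. all: by end_near. Qed.

(** A cluster point in [K] of visits at times [t i >= i] is a limit point of the trajectory. *)
Lemma positive_limit_set_meets (R : realType) (n : nat) (x : R -> 'cV[R]_n)
    (K : set 'cV[R]_n) : compact K ->
  (forall T, exists2 t, T <= t & K (x t)) -> (positive_limit_set x `&` K) !=set0.
Proof.
move=> cK freqK.
have /choice[t tE] : forall i : nat, exists t, i%:R <= t /\ K (x t).
  by move=> i; have [t] := freqK i%:R; exists t.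
have FK : \forall i \near \oo, K (x (t i)) by apply: nearW => i; exact: (tE i).2.
have [p [Kp clp]] := cK ((x \o t) @ \oo) _ FK.
exists p; split=> //; apply/positive_limit_setP => e T e0.
have FT : \forall i \near \oo, [set x s | s in [set s | T <= s]] (x (t i)).
  near=> i; exists (t i) => //=; apply: le_trans (tE i).1.
  by near: i; exact: nbhs_infty_ger.
have [_ [[s Ts <-]]] := clp _ _ FT (nbhsx_ballx p e e0).
by rewrite -ball_normE; exists s.
Unshelve. all: by end_near. Qed.

Lemma closed_positive_limit_set (R : realType) (n : nat) (x : R -> 'cV[R]_n) :
  closed (positive_limit_set x).
Proof.
move=> p clp; apply/positive_limit_setP => e T e0.
have e20 : 0 < e / 2 by rewrite divr_gt0.
have [q [/positive_limit_setP/(_ _ T e20)[t Tt qt]]] := clp _ (nbhsx_ballx p _ e20).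
rewrite -ball_normE /= => pq; exists t => //.
by rewrite (le_lt_trans (ler_distD q _ _))// (splitr e) ltrD.
Qed.

Lemma positive_limit_set_sub (R : realType) (n : nat) (x : R -> 'cV[R]_n)
    (K : set 'cV[R]_n) : closed K -> (forall t, 0 <= t -> K (x t)) ->
  positive_limit_set x `<=` K.
Proof.
move=> cK xK p /positive_limit_setP limp; apply: cK => B.
rewrite -nbhs_ballE => -[e e0 eB].
have [t t0 pt] := limp e 0 e0; exists (x t); split; first exact: xK.
by apply: eB; rewrite -ball_normE.
Qed.

Lemma compact_positive_limit_set (R : realType) (n : nat) (x : R -> 'cV[R]_n)
    (K : set 'cV[R]_n) : compact K -> (forall t, 0 <= t -> K (x t)) ->
  compact (positive_limit_set x).
Proof.
move=> cK xK; apply: (subclosed_compact _ cK); first exact: closed_positive_limit_set.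
apply: positive_limit_set_sub xK; apply: compact_closed cK.
exact: norm_hausdorff.
Qed.

Lemma continuous_near_limit (R : realType) (n : nat) (x : R -> 'cV[R]_n)
    (phi : 'cV[R]_n -> R) (p : 'cV[R]_n) (e T : R) :
  continuous phi -> positive_limit_set x p -> 0 < e ->
  exists2 t, T <= t & `|phi p - phi (x t)| < e.
Proof.
move=> phic limp e0.
have /cvgrPdist_lt/(_ e e0) := phic p.
rewrite -nbhs_ballE => -[d d0 dphi].
have [t Tt pt] := (positive_limit_setP x p).1 limp d T d0.
by exists t => //; apply: dphi; rewrite -ball_normE.
Qed.

(* If the limit set split into two separated pieces, the trajectory would keep
   crossing from one to the other, hence keep meeting the level set
   [phi = 1/2] of a Urysohn function [phi] of the two pieces, and accumulate
   there. *)
Lemma connected_positive_limit_set (R : realType) (n : nat)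
    (x : R -> 'cV[R]_n) (K : set 'cV[R]_n) : compact K ->
  (forall t, 0 <= t -> K (x t)) -> continuous x ->
  connected (positive_limit_set x).
Proof.
move=> cK xK xc; apply: contrapT => /connectedPn[E [E0 wE [sep1 sep2]]].
(* A closure point of one piece stays in the closed limit set, and separation keeps it out of the
   other piece. *)
have E_closed b : closed (E b).
  move=> p clp.
  have : positive_limit_set x p.
    apply: closed_positive_limit_set; apply: closureS clp => q Eq.
    by rewrite wE; case: b Eq; [right|left].
  rewrite wE; case: b clp => clp [] // Ep; exfalso.
    by rewrite -[False]/(set0 p) -sep2; split.
  by rewrite -[False]/(set0 p) -sep1; split.
have E_disj : E false `&` E true = set0.
  by apply/seteqP; split => // p [/subset_closure p0 p1]; rewrite -sep1.
have /(@uniform_separatorP _ R)[phi [phic _ phi0 phi1]] :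
    uniform_separator (E false) (E true).
  by apply: (@normal_separatorP R _).1 => //; exact: (@pseudometric_normal R).
have phixc : continuous (phi \o x).
  by move=> s; apply: continuous_comp; [exact: xc|exact: phic].
(* After [T] the trajectory comes close to a point where [phi] is 0, and later to one where [phi] is
   1; the value 1/2 is taken in between. *)
have half T : exists2 t, T <= t & phi (x t) = 2^-1.
  have [p0 Ep0] := E0 false; have [p1 Ep1] := E0 true.
  have limp0 : positive_limit_set x p0 by rewrite wE; left.
  have limp1 : positive_limit_set x p1 by rewrite wE; right.
  have phip0 : phi p0 = 0 by apply: phi0; exists p0.
  have phip1 : phi p1 = 1 by apply: phi1; exists p1.
  have h0 : 0 < 2^-1 :> R by rewrite invr_gt0.
  have [a Ta] := continuous_near_limit T phic limp0 h0.
  have [b ab] := continuous_near_limit a phic limp1 h0.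
  rewrite phip0 phip1 sub0r normrN !ltr_norml => /andP[_ b1] /andP[_ a0].
  have [||c] := @IVT _ (phi \o x) a b 2^-1 ab.
  - exact: continuous_subspaceT.
  - have lt_ab : phi (x a) <= phi (x b) by lra.
    by rewrite /= (min_idPl lt_ab) (max_idPr lt_ab); apply/andP; split; lra.
  by rewrite in_itv/= => /andP[ac _] ?; exists c => //; rewrite (le_trans Ta).
have [||p [limp [Kp phip]]] := @positive_limit_set_meets _ _ x (K `&` phi @^-1` [set 2^-1]).
- apply: compact_closedI => //; apply: closed_comp; first by move=> p _; exact: phic.
  exact: closed_eq.
- move=> T; have [t] := half (Num.max 0 T); rewrite ge_max => /andP[t0 Tt] phit.
  by exists t => //; split => //; exact: xK.
have h : 2^-1 != 0 :> R /\ 2^-1 != 1 :> R by split; apply/eqP; lra.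
move: limp phip h; rewrite wE => -[] Ep /= <- [/eqP h0 /eqP h1].
  by apply: h0; apply: phi0; exists p.
by apply: h1; apply: phi1; exists p.
Qed.

(** Allows the given maximal solution to be exchanged for the solution of the truncated field, which
    is only known to agree with it near nonnegative times. *)
Lemma eq_positive_limit_set (R : realType) (n : nat) (x y : R -> 'cV[R]_n) :
  (forall t, 0 <= t -> x t = y t) -> positive_limit_set x = positive_limit_set y.
Proof.
suff sub (u v : R -> 'cV[R]_n) : (forall t, 0 <= t -> u t = v t) ->
    positive_limit_set u `<=` positive_limit_set v.
  by move=> xy; apply/seteqP; split; apply: sub => // t t0; rewrite xy.
move=> uv p /positive_limit_setP limp; apply/positive_limit_setP => e T e0.
have [t] := limp e (Num.max 0 T) e0; rewrite ge_max => /andP[t0 Tt].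
by rewrite uv//; exists t.
Qed.

Lemma positive_limit_set_flow (R : realType) (n : nat)
    (g : 'cV[R]_n -> 'cV[R]_n) (L : R) (x y : R -> 'cV[R]_n) : 0 < L ->
  (forall a b, `|g a - g b| <= L * `|a - b|) ->
  (forall t : R, is_derive t 1 x (g (x t))) ->
  (forall t : R, is_derive t 1 y (g (y t))) ->
  positive_limit_set x (y 0) -> forall s, positive_limit_set x (y s).
Proof.
move=> L0 g_lip xE yE /positive_limit_setP lim0 s.
apply/positive_limit_setP => e T e0.
have E0 : 0 < 2 * expR (2 * L * `|s|) by rewrite mulr_gt0// expR_gt0.
(* The tolerance is divided by the growth factor over time [s], and [T - s] ensures [t + s >= T],
   also for negative [s]. *)
have [t Tt xt] := lim0 (e / (2 * expR (2 * L * `|s|))) (T - s) (divr_gt0 e0 E0).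
exists (t + s); first by rewrite -lerBlDr.
rewrite distrC (le_lt_trans (global_solution_dist L0 g_lip xE yE t s))//.
by rewrite mulrAC mulrC -ltr_pdivlMr// distrC.
Qed.

(** If [V q < V p], a visit near [q] followed by a later one near [p], each within half the gap,
    would make [V] increase. *)
Lemma nonincreasing_positive_limit_set (R : realType) (n : nat)
    (x : R -> 'cV[R]_n) (V : 'cV[R]_n -> R) : continuous V ->
  (forall s t, 0 <= s -> s <= t -> V (x t) <= V (x s)) ->
  forall p q, positive_limit_set x p -> positive_limit_set x q -> V p = V q.
Proof.
move=> Vc Vx.
suff V_le p q : positive_limit_set x p -> positive_limit_set x q -> V p <= V q.
  by move=> p q limp limq; apply/eqP; rewrite eq_le !V_le.
move=> limp limq; rewrite leNgt; apply/negP => Vqp.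
have e0 : 0 < (V p - V q) / 2 by rewrite divr_gt0// subr_gt0.
have [s s0] := continuous_near_limit 0 Vc limq e0.
have [t st] := continuous_near_limit s Vc limp e0.
rewrite !ltr_norml => /andP[? ?] /andP[? ?].
by have := Vx s t s0 st; lra.
Qed.

(** Fermat's rule: [y] solves the equation in both time directions, so 0 is an interior minimum. *)
Lemma grad_dot_at_min (R : realType) (n : nat) (f : 'cV[R]_n -> 'cV[R]_n)
    (V : 'cV[R]_n -> R) (y : R -> 'cV[R]_n) : (forall p, differentiable V p) ->
  (forall t : R, is_derive t 1 y (f (y t))) -> (forall t, V (y 0) <= V (y t)) ->
  grad_dot V f (y 0) = 0.
Proof.
move=> dV yE ymin.
have VyE t := is_derive_grad_dot (dV (y t)) (yE t).
have [_ <-] := VyE 0.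
suff [_ ->] : is_derive (0 : R) 1 (V \o y) 0 by [].
apply: (@derive1_at_min _ _ (- 1) 1) => [|t _||t _].
- by rewrite lerNl; lra.
- by have [] := VyE t.
- by rewrite in_itv/= ltrN10 ltr01.
- exact: ymin.
Qed.

(** * Boundedness of trajectories and location of their limit sets *)

Theorem theorem3p1 (R : realType) (n : nat)
    (f : 'cV[R]_n -> 'cV[R]_n) (V theta : 'cV[R]_n -> R)
    (f_lip : locally_lipschitz f)
    (V_C1 : continuously_differentiable V)
    (theta_C1 : continuously_differentiable theta)
    (V_le0 : forall x, grad_dot V f x <= 0)
    (theta_le0 : forall x, grad_dot V f x = 0 -> grad_dot theta f x <= 0)
    (compact_sublevel : forall z y, V y <= V z ->
      compact [set x | V x <= V z /\ theta x <= theta y])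
    (sublevel_cover : forall z, exists yz,
      [/\ V yz <= V z,
          theta z <= theta yz &
          [set x | V x <= V z] `<=`
            [set x | theta x <= theta yz] `|`
            [set x | grad_dot theta f x <= 0]]) :
  forall x0 : 'cV[R]_n,
    (exists (J : set R) (x : R -> 'cV[R]_n), the_ivp_solution f x0 J x) /\
    (forall (J : set R) (x : R -> 'cV[R]_n), the_ivp_solution f x0 J x ->
      [/\ [set t | 0 <= t] `<=` J,
          bounded_set [set x t | t in [set t | 0 <= t]] &
          [/\ positive_limit_set x !=set0,
              compact (positive_limit_set x),
              connected (positive_limit_set x),
              invariant_set f (positive_limit_set x) &
              positive_limit_set x `<=` [set p | grad_dot V f p = 0] /\
              positive_limit_set x `&`
                [set p | grad_dot theta f p = 0 /\ grad_dot V f p = 0]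
                !=set0]]).
Proof.
move=> x0; split; first exact: maximal_solution_exists.
move=> J X [solX maxX].
have [dV _] := V_C1; have [dtheta _] := theta_C1.
have [yz [Vyz theta_yz cover]] := sublevel_cover x0.
pose K := [set p | V p <= V x0 /\ theta p <= theta yz].
have cK : compact K := compact_sublevel _ _ Vyz.
have [r0 r0_ge0 Kr0] : exists2 r0 : R, 0 <= r0 & forall p, K p -> `|p| <= r0.
  have [M [_ MK]] := compact_bounded cK.
  exists (`|M| + 1) => [|p Kp]; first by rewrite addr_ge0.
  by apply: MK Kp; rewrite (le_lt_trans (ler_norm _))// ltrDl.
(* The truncation radius exceeds the radius of [K] by 1, the slack that the bootstrap argument
   requires. *)
have r_ge0 : 0 <= r0 + 1 by rewrite addr_ge0.
have [g [L [M [L0 g_lip g_le gE]]]] := truncation_exists f_lip r_ge0.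
have [x xx0 xE] := global_solution_exists L0 g_lip g_le x0.
have xc : continuous x by move=> t; exact: is_derive_continuous (xE t).
have trapped t : 0 <= t -> (forall s, 0 <= s <= t -> `|x s| <= r0 + 1) -> K (x t).
  move=> t0 xr; apply: (sublevel_forward_invariant dV dtheta V_le0 _ xc t0).
  - by move=> p /cover[]; [left|right].
  - by move=> s st; rewrite -gE ?xr.
  - by rewrite xx0.
  - by rewrite xx0.
have Kx0 : K x0 by [].
have x_le t : 0 <= t -> `|x t| <= r0.
  have xnc : continuous (fun t => `|x t|).
    by move=> s; apply: cvg_norm; exact: xc.
  apply: (continuation_bound xnc (r := r0 + 1)); first by rewrite ltrDl.
    by rewrite xx0 Kr0.
  by move=> s s0 xr; exact/Kr0/trapped.
have xK t : 0 <= t -> K (x t).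
  move=> t0; apply: trapped => // s /andP[s0 _].
  by rewrite (le_trans (x_le s s0))// lerDl.
have xf (t : R) : 0 <= t -> is_derive t 1 x (f (x t)).
  by move=> t0; rewrite -gE// (le_trans (x_le t t0))// lerDl.
(* A solution lives on an open interval, so the bound has to reach slightly past 0 into negative
   times. *)
have [d d0 xd] : exists2 d : R, 0 < d & forall t, - d < t -> `|x t| <= r0 + 1.
  have xnc : `|x t| @[t --> (0 : R)] --> `|x 0| by apply: cvg_norm; exact: xc.
  have /cvgrPdist_lt/(_ 1 ltr01)[d d0 xd] := xnc.
  exists d => // t dt; have [t0|t0] := leP 0 t.
    by rewrite (le_trans (x_le t t0))// lerDl.
  have := xd t; rewrite /= sub0r normrN ltr0_norm// ltrNl => /(_ dt).
  rewrite distrC => /(le_lt_trans (ler_norm _)); rewrite ltrBlDl => /ltW.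
  by move=> /le_trans; apply; rewrite lerD2r x_le.
have solx : ivp_solution f x0 `]- d, +oo[%classic x.
  split => //.
  - exact: interval_is_interval.
  - by rewrite /= in_itv/= oppr_lt0 d0.
  - by move=> t; rewrite /= in_itv/= andbT => dt; rewrite -gE// xd.
have [dJ xX] := maxX _ _ solx.
have t_in t : 0 <= t -> `]- d, +oo[%classic t.
  by move=> t0; rewrite /= in_itv/= andbT (lt_le_trans _ t0)// oppr_lt0.
have Xx t : 0 <= t -> X t = x t by move=> t0; rewrite xX//; exact: t_in.
rewrite (eq_positive_limit_set Xx).
have limK : positive_limit_set x `<=` K.
  by apply: positive_limit_set_sub xK; apply: compact_closed cK; exact: norm_hausdorff.
(* The complete [g]-orbit of [p] never leaves the limit set, hence stays in [K], where [g] and [f]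
   agree. *)
have flow p : positive_limit_set x p -> exists y : R -> 'cV[R]_n,
    [/\ y 0 = p, forall t : R, is_derive t 1 y (f (y t)) &
        forall t, positive_limit_set x (y t)].
  move=> limp; have [y y0 yE] := global_solution_exists L0 g_lip g_le p.
  have limy t : positive_limit_set x (y t).
    by apply: (positive_limit_set_flow L0 g_lip xE yE); rewrite y0.
  exists y; split => // t; rewrite -gE//.
  by rewrite (le_trans (Kr0 _ (limK _ (limy t))))// lerDl.
have lim_neq0 : positive_limit_set x !=set0.
  have [|p [limp _]] := positive_limit_set_meets cK (x := x); last by exists p.
  by move=> T; exists (Num.max 0 T); [rewrite le_max lexx orbT|apply: xK; rewrite le_max lexx].
have lim_compact := compact_positive_limit_set cK xK.
have Vcont : continuous V by move=> p; exact: differentiable_continuous.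
have thetacont : continuous theta by move=> p; exact: differentiable_continuous.
have Vx s t : 0 <= s -> s <= t -> V (x t) <= V (x s).
  move=> s0 st; apply: (@is_derive_lyapunov_le _ _ f V x s t) => // u /andP[su _].
  by apply: xf; exact: le_trans su.
have Vlim := nonincreasing_positive_limit_set Vcont Vx.
have limV : positive_limit_set x `<=` [set p | grad_dot V f p = 0].
  move=> p limp; have [y [y0 yE limy]] := flow p limp.
  rewrite /= -y0; apply: grad_dot_at_min => // t.
  (* [V] is constant along the orbit, so time 0 is trivially a minimum. *)
  by rewrite (Vlim (y 0) (y t)).
split; first by move=> t /t_in/dJ.
- exists r0; split; first exact: num_real.
  by move=> M0 r0M _ [t t0 <-]; rewrite /= Xx//; apply: le_trans (x_le t t0) (ltW r0M).
split => //.
- exact: connected_positive_limit_set cK xK xc.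
- move=> p limp; have [y [y0 yE limy]] := flow p limp.
  have soly : ivp_solution f p setT y by split => //; exact: openT.
  (* A solution defined for all times is maximal by uniqueness. *)
  exists y; split=> //; split=> // K' y' sol'; split=> // t K't.
  exact: (ivp_solution_unique f_lip sol' soly).
split=> //.
have [p + pmin] := compact_EVT_min lim_neq0 lim_compact
  (continuous_subspaceT thetacont).
rewrite inE => limp; have [y [y0 yE limy]] := flow p limp.
exists p; split => //; split; last exact: limV.
rewrite -y0; apply: grad_dot_at_min => // t.
by rewrite y0; apply: pmin; rewrite inE.
Qed.
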